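(* For every non-principal ideal $\mathfrak a\subset A_{\infty_1}$, $j(\mathfrak a)\neq j((1))$, where $(1)=A_{\infty_1}$.
   Context: Let $q$ be a prime power, $k=\mathbb F_q(T)$, $A=\mathbb F_q[T]$, $k_\infty=\mathbb F_q((1/T))$ with $|x|=q^{\deg_T x}$. Let $f\in k_\infty\setminus k$ be a root of $X^2-aX-b$ with $a\in A$ monic, $d=\deg_T a\ge1$, $b\in\mathbb F_q^*$, $|f|=q^d$. Let $K=k(f)\subset k_\infty$, $\infty_1$ the place of $K$ induced by this embedding, and $A_{\infty_1}=\mathbb F_q[f,fT,\dots,fT^{d-1}]$ the ring of elements of $K$ regular away from $\infty_1$. An element of $A_{\infty_1}$ is monic if it can be written $c_0+c_1(T)f+\dots+c_k(T)f^k$ with $c_0\in\mathbb F_q$, $c_i\in A$ of degree $\le d-1$ for $i\ge1$, and $c_k$ monic (for $k=0$: the element $1$). For a nonzero ideal $\mathfrak a\subset A_{\infty_1}$, $\zeta^{\mathfrak a}(n(q-1))=\sum_{0\ne x\in\mathfrak a\text{ monic}}x^{n(1-q)}$, $J(\mathfrak a)=\frac{T^{q^2}-T}{(T^q-T)^{q+1}}\cdot\frac{\zeta^{\mathfrak a}(q^2-1)}{\zeta^{\mathfrak a}(q-1)^{q+1}}$, $j(\mathfrak a)=\big(\frac1{T^q-T}-J(\mathfrak a)\big)^{-1}$; $j(\mathfrak a)$ depends only on the ideal class of $\mathfrak a$. *)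

(* Defs.v *)
(* Concrete model of k_oo = F_q((1/T)) given axiomatically as a
   field L together with a ring isomorphism onto Laurent series in 1/T. *)
From HB Require Import structures.
From mathcomp Require Import all_boot all_order all_algebra.
From Stdlib Require Import ClassicalEpsilon.

Set Implicit Arguments.
Unset Strict Implicit.
Unset Printing Implicit Defensive.

Import Order.TTheory GRing.Theory Num.Theory.
Local Open Scope ring_scope.

(* Coefficient of T^i in the product of two Laurent series c, e in 1/T
   whose coefficients vanish above N1, resp. N2. *)
Definition lmul_coef (F : pzRingType) (c e : int -> F) (N1 N2 i : int) : F :=
  if i <= N1 + N2 then
    \sum_(k < (absz (N1 + N2 - i)%R).+1) c (i - N2 + k%:Z) * e (N2 - k%:Z)
  else 0.

(* L together with lcoef is (isomorphic to) F((1/T)): lcoef x i is the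
   coefficient of T^i of x; lcoef is a bijective ring morphism onto the
   coefficient functions vanishing for large i. *)
Record laurent_model (F : finFieldType) (L : fieldType) := LaurentModel {
  lcoef : L -> int -> F;
  lcst : F -> L;
  lT : L;
  lcoef_inj : injective lcoef;
  lcoef_bounded : forall x, exists N : int, forall i, N < i -> lcoef x i = 0;
  lcoef_surj : forall c : int -> F,
      (exists N : int, forall i, N < i -> c i = 0) -> exists x, lcoef x = c;
  lcoef_add : forall x y i, lcoef (x + y) i = lcoef x i + lcoef y i;
  lcoef_mul : forall x y (N1 N2 : int),
      (forall i, N1 < i -> lcoef x i = 0) -> (forall i, N2 < i -> lcoef y i = 0) ->
      forall i, lcoef (x * y) i = lmul_coef (lcoef x) (lcoef y) N1 N2 i;
  lcoef_cst : forall c i, lcoef (lcst c) i = if i == 0 then c else 0;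
  lcoef_T : forall i, lcoef lT i = if i == 1 then 1 else 0 }.

Section Defs.
Variables (F : finFieldType) (L : fieldType) (M : laurent_model F L).
Variables (f : L) (d : nat).

Definition ev (p : {poly F}) : L := (map_poly (lcst M) p).[lT M].

(* |y| < q^m, i.e. all coefficients of T^i, i >= m, vanish *)
Definition small (m : int) (y : L) : Prop := forall i, m <= i -> lcoef M y i = 0.

Inductive inA : L -> Prop :=
| inA_cst c : inA (lcst M c)
| inA_gen i : (i < d)%N -> inA (f * lT M ^+ i)
| inA_add x y : inA x -> inA y -> inA (x + y)
| inA_mul x y : inA x -> inA y -> inA (x * y).

Definition is_ideal (I : L -> Prop) : Prop :=
  [/\ forall x, I x -> inA x, I 0,
      forall x y, I x -> I y -> I (x + y) &
      forall r x, inA r -> I x -> I (r * x)].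

Definition principal (I : L -> Prop) : Prop :=
  exists g, inA g /\ forall x, I x <-> exists r, inA r /\ x = r * g.

Definition monicA (x : L) : Prop :=
  x = 1 \/
  exists (k : nat) (c0 : F) (cs : nat -> {poly F}),
    [/\ (0 < k)%N, forall i, (size (cs i) <= d)%N, cs k \is monic &
        x = lcst M c0 + \sum_(1 <= i < k.+1) ev (cs i) * f ^+ i].

(* unconditional (net over finite subsets) sum in k_oo *)
Definition HasSum (S : L -> Prop) (g : L -> L) (l : L) : Prop :=
  forall m : int, exists s0 : seq L, (forall x, x \in s0 -> S x) /\
    forall s : seq L, uniq s -> (forall x, x \in s -> S x) -> {subset s0 <= s} ->
      small m (\sum_(x <- s) g x - l).

Definition sumL (S : L -> Prop) (g : L -> L) : L :=
  epsilon (inhabits 0) (HasSum S g).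

Definition q : nat := #|F|.

(* zeta^I (n (q-1)) = sum over nonzero monic x in I of x^(n(1-q)) *)
Definition zetaI (I : L -> Prop) (n : nat) : L :=
  sumL (fun x => [/\ I x, x <> 0 & monicA x]) (fun x => x^-1 ^+ (n * (q - 1))).

Definition JI (I : L -> Prop) : L :=
  (lT M ^+ (q ^ 2) - lT M) / (lT M ^+ q - lT M) ^+ q.+1
  * (zetaI I q.+1 / zetaI I 1 ^+ q.+1).

Definition jI (I : L -> Prop) : L := ((lT M ^+ q - lT M)^-1 - JI I)^-1.

End Defs.

(* Main.v *)
(* Scale a nonzero ideal [I] by a monic element of least degree to get a lattice
   containing [1], whose other monic elements have degree at least [m >= 1], with [m]
   attained.  Summing over cosets of [F_q], where
   [\sum_c (y + c)^(1-q) = (y^q - y) / (y^(q^2) - y^q)], gives [zeta(q-1) = 1 + delta]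
   with [deg delta = - q (q-1) m] exactly, while [zeta(q^2-1) = 1 + O(T^(-(q^2-1) m))].
   Hence [zeta(q^2-1) / zeta(q-1)^(q+1) - 1] has degree exactly [- q (q-1) m], and
   [j(I)] determines [m].  For [I = A], whose elements have degrees [0] and all
   [n >= d], one has [m = d].  If [m >= d] for [I], then [I] has no more degrees than
   [x0 A], where [x0] is its element of least degree, so [I = x0 A] is principal. *)
Require Import Defs.
From HB Require Import structures.
From mathcomp Require Import all_boot all_order all_algebra all_field.
From mathcomp Require Import boolp zify ring.
From Stdlib Require ClassicalEpsilon.
Import Order.TTheory GRing.Theory Num.Theory.
Local Open Scope ring_scope.

Set Implicit Arguments.
Unset Strict Implicit.
Unset Printing Implicit Defensive.

(** * Degrees of Laurent series *)

Section Degree.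
Variables (F : finFieldType) (L : fieldType) (M : laurent_model F L).
Local Notation co := (lcoef M).
Local Notation cst := (lcst M).

Definition dle (m : int) (x : L) : Prop := forall i, m < i -> co x i = 0.

(** For nonzero [c] this says that [x] has degree exactly [m] in T with leading coefficient [c]; for
    [c = 0] it is only a degree bound. *)
Definition lead (x : L) (m : int) (c : F) : Prop := dle m x /\ co x m = c.

Lemma lcoef0 i : co 0 i = 0.
Proof. by apply: (addrI (co 0 i)); rewrite -lcoef_add !addr0. Qed.

Lemma lcoefN x i : co (- x) i = - co x i.
Proof. by apply: (addrI (co x i)); rewrite -lcoef_add !subrr lcoef0. Qed.

Lemma lcoefB x y i : co (x - y) i = co x i - co y i.
Proof. by rewrite lcoef_add lcoefN. Qed.

Lemma lcoef_eq x y : (forall i, co x i = co y i) -> x = y.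
Proof. by move=> h; apply: (@lcoef_inj _ _ M); apply: funext. Qed.

Lemma dle0 m : dle m 0.
Proof. by move=> i _; rewrite lcoef0. Qed.

Lemma dleD m x y : dle m x -> dle m y -> dle m (x + y).
Proof. by move=> hx hy i hi; rewrite lcoef_add hx ?hy ?addr0. Qed.

Lemma dleN m x : dle m x -> dle m (- x).
Proof. by move=> hx i hi; rewrite lcoefN hx ?oppr0. Qed.

Lemma dleB m x y : dle m x -> dle m y -> dle m (x - y).
Proof. by move=> hx hy; apply: dleD => //; apply: dleN. Qed.

Lemma dle_sum (I : eqType) m (s : seq I) (P : pred I) (g : I -> L) :
  (forall x, x \in s -> P x -> dle m (g x)) -> dle m (\sum_(x <- s | P x) g x).
Proof.
move=> h; rewrite big_seq_cond; elim/big_rec: _ => [|x y /andP[xs Px] hy].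
  exact: dle0.
by apply: dleD hy; apply: h.
Qed.

Lemma dle_trans m n x : m <= n -> dle m x -> dle n x.
Proof. by move=> mn h i hi; apply: h; apply: le_lt_trans hi. Qed.

Lemma dle_mul m n x y : dle m x -> dle n y -> dle (m + n) (x * y).
Proof.
by move=> hx hy i hi; rewrite (lcoef_mul hx hy) /lmul_coef leNgt hi.
Qed.

Lemma lcoef_mul_top m n x y : dle m x -> dle n y ->
  co (x * y) (m + n) = co x m * co y n.
Proof.
move=> hx hy; rewrite (lcoef_mul hx hy) /lmul_coef lexx subrr.
by rewrite big_ord1 /= subr0 addr0 addrK.
Qed.

Lemma dle_cst c : dle 0 (cst c).
Proof. by move=> i hi; rewrite lcoef_cst gt_eqF. Qed.

Lemma lcoef_cstM c y i : co (cst c * y) i = c * co y i.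
Proof.
have [n hn] := lcoef_bounded M y.
have hy : dle n y by [].
rewrite (lcoef_mul (@dle_cst c) hy) /lmul_coef add0r.
case: leP => hi; last by rewrite hy ?mulr0.
(* Only the index n - i survives: there the constant is read at exponent 0. *)
have hk : (`|n - i| < `|n - i|.+1)%N by [].
rewrite (bigD1 (Ordinal hk)) //= big1 ?addr0.
  have -> : (`|n - i|%:Z = n - i)%R by rewrite gez0_abs // subr_ge0.
  by rewrite lcoef_cst addrA subrK subrr eqxx opprB addrC subrK.
move=> j hj; rewrite lcoef_cst; case: eqP => [e|]; last by rewrite mul0r.
case/negP: hj; apply/eqP/val_inj => /=; move: e; move: (nat_of_ord j) => k e.
by clear -e hi; lia.
Qed.

Lemma lcstM c e : cst (c * e) = cst c * cst e.
Proof.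
by apply: lcoef_eq => i; rewrite lcoef_cstM !lcoef_cst; case: eqP; rewrite ?mulr0.
Qed.

Lemma lcst1 : cst 1 = 1.
Proof.
rewrite -[LHS]mulr1; apply: lcoef_eq => i.
by rewrite lcoef_cstM mul1r.
Qed.

Lemma lcstB c e : cst (c - e) = cst c - cst e.
Proof.
by apply: lcoef_eq => i; rewrite lcoefB !lcoef_cst; case: eqP; rewrite ?subr0.
Qed.

HB.instance Definition _ := GRing.isZmodMorphism.Build F L cst lcstB.
HB.instance Definition _ :=
  GRing.isMonoidMorphism.Build F L cst (lcst1, lcstM).

Lemma lead_uniq x m c m' c' : c != 0 -> c' != 0 ->
  lead x m c -> lead x m' c' -> m = m' /\ c = c'.
Proof.
move=> c0 c0' [h1 h2] [h1' h2'].
case: (ltgtP m m') => e; last by subst m'; rewrite -h2 -h2'.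
  by rewrite -h2' h1 ?eqxx in c0'.
by rewrite -h2 h1' ?eqxx in c0.
Qed.

Lemma lead_neq0 x m c : c != 0 -> lead x m c -> x != 0.
Proof. by move=> c0 [_ h]; apply: contraNneq c0 => x0; rewrite -h x0 lcoef0. Qed.

Lemma lead_cst c : lead (cst c) 0 c.
Proof. by split; [apply: dle_cst | rewrite lcoef_cst]. Qed.

Lemma lead1 : lead 1 0 1.
Proof. by rewrite -lcst1; apply: lead_cst. Qed.

Lemma leadM x y m n c e : lead x m c -> lead y n e -> lead (x * y) (m + n) (c * e).
Proof.
move=> [h1 h2] [h1' h2']; split; first exact: dle_mul.
by rewrite lcoef_mul_top // h2 h2'.
Qed.

Lemma lead_cstM x m c e : lead x m c -> lead (cst e * x) m (e * c).
Proof. by move=> h; rewrite -[m]add0r; apply: leadM => //; apply: lead_cst. Qed.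

Lemma leadDl x y m n c : n < m -> lead x m c -> dle n y -> lead (x + y) m c.
Proof.
move=> nm [h1 h2] hy; split.
  by apply: dleD h1 _; apply: dle_trans hy; apply: ltW.
by rewrite lcoef_add h2 hy ?addr0.
Qed.

Lemma lead_exists x : x != 0 -> exists m c, c != 0 /\ lead x m c.
Proof.
move=> x0; have [N hN] := lcoef_bounded M x.
have [i hi] : exists i, co x i <> 0.
  apply: contrapT => /forallNP h; move/eqP: x0; apply; apply: lcoef_eq => i.
  by rewrite lcoef0; apply: contrapT; apply: h.
(* Counting down from the bound [N], the first nonzero coefficient met is the leading one. *)
pose P (k : nat) := co x (N - k%:Z) != 0.
have exP : exists k, P k.
  exists `|N - i|%N; rewrite /P gez0_abs.
    by rewrite opprB addrC subrK; apply/eqP.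
  by rewrite subr_ge0 leNgt; apply/negP => /hN.
case: (ex_minnP exP) => k hk kmin; exists (N - k%:Z), (co x (N - k%:Z)).
split => //; split => // j hj; have [/hN //|jN] := ltP N j.
apply/eqP; apply: contraTT hj => hj.
have -> : j = N - `|N - j|%N%:Z by lia.
have /kmin : P `|N - j|%N.
  by rewrite /P; have -> : N - `|N - j|%N%:Z = j by lia.
by rewrite -leNgt; lia.
Qed.

(** The inverse has some degree and leading coefficient; comparing those of [x * x^-1] with those of
    1 identifies them. *)
Lemma leadV x m c : c != 0 -> lead x m c -> lead x^-1 (- m) c^-1.
Proof.
move=> c0 hx; have x0 := lead_neq0 c0 hx.
have [n [e [e0 hy]]] : exists n e, e != 0 /\ lead x^-1 n e.
  by apply: lead_exists; rewrite invr_eq0.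
have := leadM hx hy; rewrite divff // => h.
have [h1 h2] := lead_uniq (oner_neq0 F) (mulf_neq0 c0 e0) lead1 h.
have -> : - m = n by lia.
suff -> : c^-1 = e by [].
by apply: (mulfI c0); rewrite divff.
Qed.

Lemma leadX x m c n : lead x m c -> lead (x ^+ n) (m * n%:Z) (c ^+ n).
Proof.
move=> h; elim: n => [|n IH]; first by rewrite !expr0 mulr0; apply: lead1.
rewrite !exprS; have -> : m * n.+1%:Z = m + m * n%:Z by lia.
exact: leadM.
Qed.

Lemma lead_dle_lt x m n c : c != 0 -> lead x m c -> dle n x -> m <= n.
Proof.
by move=> c0 [_ hm] hn; rewrite leNgt; apply: contra c0 => nm; rewrite -hm hn.
Qed.

Lemma lead_sub x y m c : lead x m c -> lead y m c -> dle (m - 1) (x - y).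
Proof.
move=> [h1 h2] [h1' h2'] i hi; rewrite lcoefB.
have [->|im] := eqVneq i m; first by rewrite h2 h2' subrr.
by rewrite h1 ?h1' ?subrr //; lia.
Qed.

(** * Degrees of polynomials in T *)

Lemma lead_X : lead (lT M) 1 1.
Proof. by split => [i hi|]; rewrite lcoef_T // gt_eqF. Qed.

Lemma ev_is_zmod_morphism : zmod_morphism (ev M).
Proof. by move=> p r; rewrite /ev rmorphB hornerD hornerN. Qed.

Lemma ev_is_monoid_morphism : monoid_morphism (ev M).
Proof. by split=> [|p r]; rewrite /ev ?rmorph1 ?hornerC // rmorphM hornerM. Qed.

HB.instance Definition _ :=
  GRing.isZmodMorphism.Build {poly F} L (ev M) ev_is_zmod_morphism.
HB.instance Definition _ :=
  GRing.isMonoidMorphism.Build {poly F} L (ev M) ev_is_monoid_morphism.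

Lemma evC c : ev M c%:P = cst c.
Proof. by rewrite /ev map_polyC hornerC. Qed.

Lemma evX : ev M 'X = lT M.
Proof. by rewrite /ev map_polyX hornerX. Qed.

Lemma evZ c p : ev M (c *: p) = cst c * ev M p.
Proof. by rewrite -mul_polyC rmorphM /= evC. Qed.

Lemma lead_ev p : p != 0 -> lead (ev M p) (size p).-1%:Z (lead_coef p).
Proof.
elim/poly_ind: p => [|p c IH]; first by rewrite eqxx.
rewrite rmorphD rmorphM /= evX evC => h.
have [p0|p0] := eqVneq p 0.
  rewrite p0 mul0r add0r raddf0 mul0r add0r size_polyC lead_coefC.
  move: h; rewrite p0 mul0r add0r polyC_eq0 => -> /=; exact: lead_cst.
rewrite lead_coefDl; last first.
  rewrite size_mulX // size_polyC; move: p0; rewrite -size_poly_gt0.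
  by case: (c != 0); lia.
rewrite lead_coefMX size_MXaddC (negPf p0) /=.
apply: (@leadDl _ _ _ 0); last exact: dle_cst.
  by rewrite ltz_nat size_poly_gt0.
have -> : (size p)%:Z = (size p).-1%:Z + 1.
  by move: p0; rewrite -size_poly_gt0; lia.
by rewrite -[lead_coef p]mulr1; apply: leadM (IH p0) lead_X.
Qed.

Lemma dle_ev (p : {poly F}) m : (size p <= m.+1)%N -> dle m%:Z (ev M p).
Proof.
move=> h; have [->|p0] := eqVneq p 0; first by rewrite raddf0; apply: dle0.
have [+ _] := lead_ev p0; apply: dle_trans; move: p0; rewrite -size_poly_gt0; lia.
Qed.
End Degree.

(** * Unconditional sums *)

(** One preimage is chosen for each value in the finite type; injectivity makes this list exhaust
    [P]. *)
Lemma seq_of_inj (T : eqType) (V : finType) (P : T -> Prop) (h : T -> V) :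
  (forall x y, P x -> P y -> h x = h y -> x = y) ->
  exists s, uniq s /\ forall x, x \in s <-> P x.
Proof.
move=> inj.
pose g v := if pselect (exists x, P x /\ h x = v) is left e
            then Some (projT1 (cid e)) else None.
exists (undup (pmap g (enum V))); split; first exact: undup_uniq.
move=> x; rewrite mem_undup mem_pmap; split.
  case/mapP => v _; rewrite /g; case: pselect => // e [->].
  by case: (cid e) => y [].
move=> Px; apply/mapP; exists (h x); first by rewrite mem_enum.
rewrite /g; case: pselect => [e|[]]; last by exists x.
by case: (cid e) => y [Py hy] /=; congr Some; apply: inj.
Qed.

Section Sums.
Variables (F : finFieldType) (L : fieldType) (M : laurent_model F L).
Variables (S : L -> Prop) (g : L -> L).
Local Notation co := (lcoef M).
Local Notation dle := (dle M).

Lemma dle_bound_seq (s : seq L) : exists N : nat, forall x, x \in s -> dle N%:Z x.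
Proof.
elim: s => [|x s [N IH]]; first by exists 0%N.
have [n hn] := lcoef_bounded M x.
exists (maxn N `|n|%N) => y; rewrite inE => /orP[/eqP ->|/IH].
  by apply: dle_trans hn; lia.
by apply: dle_trans; lia.
Qed.

(** The finite set witnessing the net limit has bounded degree, so it lies in any set that contains
    all elements of [S] up to that degree. *)
Lemma HasSum_limit l (m : int) : HasSum M S g l ->
  exists N0 : nat, forall s, uniq s -> (forall x, x \in s -> S x) ->
    (forall x, S x -> dle N0%:Z x -> x \in s) ->
    dle m (\sum_(x <- s) g x - l).
Proof.
(* [small (m + 1)] is the same condition as [dle m]. *)
move=> /(_ (m + 1)) [s0 [s0S hs0]]; have [N hN] := dle_bound_seq s0.
exists N => s us sS hs i hi; apply: (hs0 s us sS); last by lia.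
by move=> x xs0; apply: hs; [apply: s0S | apply: hN].
Qed.

Hypothesis fin : forall N : nat,
  exists s, uniq s /\ forall x, x \in s <-> S x /\ dle N%:Z x.
Hypothesis decay :
  forall (N : nat) x, S x -> ~ dle N%:Z x -> dle (- N.+1%:Z) (g x).

Lemma HasSum_exists : exists l, HasSum M S g l.
Proof.
have [s hs] := choice fin; pose P N := \sum_(x <- s N) g x.
have tail N t : uniq t -> (forall x, x \in t -> S x) -> {subset s N <= t} ->
    dle (- N.+1%:Z) (\sum_(x <- t) g x - P N).
  move=> ut tS sub; have [us sN] := hs N.
  have hp : perm_eq t (s N ++ [seq x <- t | x \notin s N]).
    apply: uniq_perm => // [|x].
      rewrite cat_uniq us filter_uniq // andbT -all_predC.
      by apply/allP => x; rewrite mem_filter => /andP[].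
    rewrite mem_cat mem_filter; case: (boolP (x \in s N)) => //= /sub //.
  rewrite (perm_big _ hp) big_cat /= -/(P N) [_ - P N]addrAC subrr add0r.
  apply: dle_sum => x.
  rewrite mem_filter => /andP[/negP h xt] _; apply: decay; first exact: tS.
  by move=> hx; apply: h; apply/sN; split => //; apply: tS.
have tailP N n : (N <= n)%N -> dle (- N.+1%:Z) (P n - P N).
  move=> Nn; apply: tail; first by have [] := hs n.
    by move=> x xs; have [_ /(_ x)[/(_ xs)[]]] := hs n.
  move=> x; case: (hs N) (hs n) => _ hN [_ hn] /hN[Sx hx].
  by apply/hn; split=> //; apply: dle_trans hx; rewrite lez_nat.
(* Elements of degree above N contribute only to exponents below -N, so the coefficient of T^i is
   stationary from the partial sum of index |i| on. *)
have [l hl] : exists l, co l = fun i => co (P `|i|%N) i.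
  apply: lcoef_surj; have [B hB] := lcoef_bounded M (P 0%N).
  exists (Num.max B 0) => i; rewrite gt_max => /andP[Bi i0].
  have := @tailP 0%N `|i|%N (leq0n _) i; rewrite lcoefB hB // subr0; apply.
  by apply: lt_trans i0.
have Pl N : dle (- N.+1%:Z) (P N - l).
  move=> i hi; rewrite lcoefB hl; apply/eqP; rewrite subr_eq0; apply/eqP.
  case: (leqP `|i|%N N) => iN; apply: subr0_eq; rewrite -lcoefB.
    by apply: (tailP _ _ iN); lia.
  rewrite -[LHS]opprK -lcoefN opprB; apply/eqP; rewrite oppr_eq0; apply/eqP.
  by apply: (tailP _ _ (ltnW iN)).
exists l => m; exists (s `|m|%N); have [_ sm] := hs `|m|%N; split.
  by move=> x /sm[].
move=> t ut tS sub; have := dleD (tail _ _ ut tS sub) (Pl `|m|%N).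
rewrite addrA subrK => h i hi; apply: h; lia.
Qed.
End Sums.

Lemma HasSum_scale (F : finFieldType) (L : fieldType) (M : laurent_model F L)
    (S : L -> Prop) (u l : L) (e : nat) : u != 0 ->
  HasSum M S (fun x => x^-1 ^+ e) l ->
  HasSum M (fun x => S (u * x)) (fun x => x^-1 ^+ e) (u ^+ e * l).
Proof.
move=> u0 h m.
have ue0 : u ^+ e != 0 by rewrite expf_neq0.
have [n [c [c0 hu]]] := lead_exists M ue0.
(* Multiplication by [u ^+ e], of degree [n], costs [n] in precision. *)
have [s0 [s0S hs0]] := h (m - n).
exists [seq u^-1 * x | x <- s0]; split.
  by move=> x /mapP[y ys ->]; rewrite mulVKf //; apply: s0S.
move=> s us sS sub i hi.
have -> : \sum_(x <- s) x^-1 ^+ e - u ^+ e * l =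
    u ^+ e * (\sum_(x <- [seq u * x | x <- s]) x^-1 ^+ e - l).
  rewrite mulrBr big_map mulr_sumr; congr (_ - _); apply: eq_bigr => x _.
  by rewrite invfM exprMn mulrA -exprMn divff // expr1n mul1r.
have hd : dle M (m - n - 1) (\sum_(x <- [seq u * x | x <- s]) x^-1 ^+ e - l).
  move=> j hj; apply: hs0; last by lia.
  - by rewrite map_inj_uniq //; apply: mulfI.
  - by move=> x /mapP[y ys ->]; apply: sS.
  - move=> x xs; apply/mapP; exists (u^-1 * x); last by rewrite mulVKf.
    by apply: sub; apply: map_f.
by apply: (dle_mul (proj1 hu) hd); lia.
Qed.

(** * Sums over translates by the constants *)

(** Logarithmic derivative of a product of linear factors. *)
Lemma horner_deriv_prod (K : fieldType) (s : seq K) (z : K) : z \notin s ->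
  (\prod_(c <- s) ('X - c%:P))^`().[z] =
  (\prod_(c <- s) (z - c)) * \sum_(c <- s) (z - c)^-1.
Proof.
elim: s => [|c s IH]; first by rewrite !big_nil derivC horner0 mulr0.
rewrite inE negb_or => /andP[zc zs]; rewrite !big_cons derivM derivXsubC mul1r.
rewrite !hornerE IH // horner_prod.
under eq_bigr do rewrite hornerXsubC.
have h : z - c != 0 by rewrite subr_eq0.
by field.
Qed.

Section CosetSum.
Variables (F : finFieldType) (L : fieldType) (iota : {rmorphism F -> L}).

Lemma pnat_card : [pchar L].-nat #|F|.
Proof.
have [p p_pr pF] := finPcharP F.
rewrite (card_pprimeChar pF) pnatX pnatE //; apply/orP; left.
by rewrite (rmorph_pchar iota pF).
Qed.

Lemma card_eq0 : #|F|%:R = 0 :> F.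
Proof.
have [p p_pr pF] := finPcharP F.
have := finNzRing_gt1 F; rewrite (card_pprimeChar pF) => h.
rewrite natrX (pcharf0 pF) expr0n; case: eqP h => // ->.
by rewrite expn0.
Qed.

Lemma exprD_card (x y : L) : (x + y) ^+ #|F| = x ^+ #|F| + y ^+ #|F|.
Proof. by apply: exprDn_pchar; apply: pnat_card. Qed.

(** Logarithmic derivative of X^q - X, the product of all X - c, whose derivative is -1 because q =
    0 in [F]. *)
Lemma sum_inv_translates (z : L) : (forall c, z + iota c != 0) ->
  \sum_(c : F) (z + iota c)^-1 = - (z ^+ #|F| - z)^-1.
Proof.
move=> hz.
have e : 'X^#|F| - 'X = \prod_(c <- [seq iota c | c <- enum F]) ('X - c%:P).
  rewrite big_map big_enum /=.
  have := congr1 (map_poly iota) (finField_genPoly F).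
  rewrite rmorphB /= map_polyXn map_polyX rmorph_prod => ->.
  by apply: eq_bigr => c _; rewrite rmorphB /= map_polyX map_polyC.
have zn : z \notin [seq iota c | c <- enum F].
  apply/negP => /mapP[c _ zc]; move: (hz (- c)).
  by rewrite rmorphN zc subrr eqxx.
have := horner_deriv_prod zn; rewrite -e.
have := congr1 (fun p : {poly L} => p.[z]) e; rewrite /= horner_prod.
under eq_bigr do rewrite hornerXsubC.
move=> <-; rewrite derivB derivXn derivX !hornerE hornerMn -mulr_natr.
rewrite -(rmorph_nat iota).
rewrite card_eq0 rmorph0 mulr0 sub0r big_map big_enum /=.
(* Replacing c by -c turns z - c into z + c. *)
rewrite (reindex_inj oppr_inj) /=.
under eq_bigr do rewrite rmorphN opprK.
move=> h; have D0 : z ^+ #|F| - z != 0.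
  by apply: contra_eq_neq h => ->; rewrite mul0r oppr_eq0 oner_neq0.
by apply: (mulfI D0); rewrite -h mulrN divff.
Qed.

(* [(z + c)^(1-q) = (z + c) / (z^q + c) = 1 + (z - z^q) / (z^q + c)] *)
Lemma coset_sum (z : L) : (forall c, z + iota c != 0) ->
  \sum_(c : F) (z + iota c)^-1 ^+ #|F|.-1 =
  (z ^+ #|F| - z) / ((z ^+ #|F|) ^+ #|F| - z ^+ #|F|).
Proof.
move=> hz; have hZ c : z ^+ #|F| + iota c != 0.
  by rewrite -[c in iota c]expf_card rmorphXn -exprD_card expf_neq0.
have q0 : (0 < #|F|)%N by apply: ltnW; apply: finNzRing_gt1.
have -> : \sum_(c : F) (z + iota c)^-1 ^+ #|F|.-1 =
    \sum_(c : F) (1 + (z - z ^+ #|F|) * (z ^+ #|F| + iota c)^-1).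
  apply: eq_bigr => c _.
  have -> : (z + iota c)^-1 ^+ #|F|.-1 = (z + iota c) / (z + iota c) ^+ #|F|.
    apply: (mulfI (expf_neq0 #|F|.-1 (hz c))).
    rewrite -exprMn divff // expr1n mulrA -exprSr prednK // divff //.
    exact: expf_neq0.
  rewrite exprD_card -(rmorphXn iota) expf_card; have := hZ c => h.
  by field.
rewrite big_split /= -mulr_sumr sum_inv_translates // sumr_const.
rewrite -(rmorph_nat iota) card_eq0 rmorph0.
by rewrite add0r mulrN -mulNr opprB.
Qed.
End CosetSum.

(** * Eisenstein sums of a lattice *)

Section Lattice.
Variables (F : finFieldType) (L : fieldType) (M : laurent_model F L).
Local Notation co := (lcoef M).
Local Notation cst := (lcst M).
Local Notation dle := (dle M).
Local Notation lead := (lead M).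
Local Notation q := #|F|.

Variable A : L -> Prop.
Hypothesis AD : forall x y, A x -> A y -> A (x + y).
Hypothesis AZ : forall c x, A x -> A (cst c * x).
Hypothesis A1 : A 1.
Hypothesis discrete : forall x, A x -> dle (-1) x -> x = 0.

(** Leading coefficient 1, unlike the form of [monicA], is preserved when an ideal is rescaled by a
    monic element. *)
Definition monic_part (x : L) := A x /\ exists m, lead x m 1.
Local Notation S := monic_part.

Let q_gt1 : (1 < q)%N := finNzRing_gt1 F.

Let Acst c : A (cst c).
Proof. by rewrite -[cst c]mulr1; apply: AZ. Qed.

Let AB x y : A x -> A y -> A (x - y).
Proof.
move=> hx hy; apply: AD => //; rewrite -mulN1r -(rmorph1 cst) -rmorphN.
exact: AZ.
Qed.

Let lead1_neq0 x m : lead x m 1 -> x != 0.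
Proof. exact: lead_neq0 (oner_neq0 F). Qed.

(** The coefficients of T^0, ..., T^N determine the element: if they agree, the difference lies in
    [A] and has negative degree, so it vanishes. *)
Lemma finite_monic_part (N : nat) :
  exists s, uniq s /\ forall x, x \in s <-> S x /\ dle N%:Z x.
Proof.
apply: (@seq_of_inj _ _ _ (fun x => [ffun i : 'I_N.+1 => co x i%:Z])).
move=> x y [[Ax _] hx] [[Ay _] hy] /ffunP e.
apply/subr0_eq/discrete; first exact: AB.
move=> i hi; have -> : i = `|i|%N%:Z by lia.
rewrite lcoefB; case: (leqP `|i|%N N) => iN.
  by have := e (Ordinal (iN : (`|i| < N.+1)%N)); rewrite !ffunE /= => ->; rewrite subrr.
by rewrite hx ?hy ?subrr // ltz_nat.
Qed.

Let decay e (N : nat) x : (0 < e)%N -> S x -> ~ dle N%:Z x ->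
  dle (- N.+1%:Z) (x^-1 ^+ e).
Proof.
move=> e0 [Ax [m hx]] hN.
have [+ _] := leadX e (leadV (oner_neq0 F) hx); apply: dle_trans.
have mN : N%:Z < m.
  by rewrite ltNge; apply/negP => mN; apply: hN; apply: dle_trans (proj1 hx).
nia.
Qed.

Lemma HasSum_monic_part e : (0 < e)%N ->
  exists l, HasSum M S (fun x => x^-1 ^+ e) l.
Proof.
move=> e0; apply: HasSum_exists; first exact: finite_monic_part.
by move=> N x; apply: decay.
Qed.

Variables (m1 : nat) (x1 : L).
Hypothesis m1_gt0 : (0 < m1)%N.
Hypothesis Ax1 : A x1.
Hypothesis lead_x1 : lead x1 m1%:Z 1.
Hypothesis gap : forall x, A x -> dle (m1%:Z - 1) x -> exists c, x = cst c.

Let S_ge x m : A x -> lead x m 1 -> x = 1 \/ m1%:Z <= m.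
Proof.
move=> Ax hx; case: (lerP m1%:Z m) => mm; [by right | left].
have [|c hc] := gap Ax.
  by apply: dle_trans (proj1 hx); lia.
move: hx; rewrite hc => hx; have c0 : c != 0.
  by apply: contraTneq (lead1_neq0 hx) => ->; rewrite rmorph0 eqxx.
have [_ ->] := lead_uniq c0 (oner_neq0 _) (lead_cst M c) hx.
exact: rmorph1.
Qed.

Let HasSum_approx e l (k : int) : HasSum M S (fun x => x^-1 ^+ e) l ->
  exists (N : nat) s, [/\ (m1 <= N)%N, uniq s,
    forall x, x \in s <-> S x /\ dle N%:Z x &
    dle k (\sum_(x <- s) x^-1 ^+ e - l)].
Proof.
move=> /(@HasSum_limit _ _ _ _ _ _ k)[N hN].
(* The maximum makes the truncation reach the degree of [x1]. *)
have [s [us sN]] := finite_monic_part (maxn N m1).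
exists (maxn N m1), s; split => //; first exact: leq_maxr.
apply: hN => // [x /sN[]//|x Sx hx]; apply/sN; split => //.
by apply: dle_trans hx; lia.
Qed.

Let S1 : S 1.
Proof. by split => //; exists 0; apply: lead1. Qed.

(** The element 1 contributes 1, and every other monic element has degree at least [m1]. *)
Lemma zeta_sub1_dle e l : HasSum M S (fun x => x^-1 ^+ e) l ->
  dle (- (e * m1)%N%:Z) (l - 1).
Proof.
move=> /(HasSum_approx (- (e * m1)%N%:Z))[N [s [m1N us sN h]]].
have s1 : 1 \in s by apply/sN; split => //; apply: dle_trans (proj1 (lead1 M)).
move: h; rewrite (perm_big _ (perm_to_rem s1)) big_cons invr1 expr1n.
set R := \sum_(j <- _) _ => h.
have hR : dle (- (e * m1)%N%:Z) R.
  apply: dle_sum => x; rewrite mem_rem_uniq // inE.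
  move=> /andP[/= x_neq1 /sN[[Ax [m hx]] _]] _.
  case: (S_ge Ax hx) => [/eqP|]; first by rewrite (negPf x_neq1).
  move=> mm; have [+ _] := leadX e (leadV (oner_neq0 F) hx).
  by apply: dle_trans; nia.
have -> : l - 1 = R - (1 + R - l) by ring.
exact: dleB.
Qed.

(** The representative of the coset of [x1] modulo constants whose coefficient at T^0 is zero. *)
Let x1' := x1 - cst (co x1 0).

Let lead_x1' : lead x1' m1%:Z 1.
Proof.
apply: (@leadDl _ _ M _ _ _ 0); first by lia.
  exact: lead_x1.
by apply: dleN; apply: dle_cst.
Qed.

(** In the closed form of the coset sum the numerator has degree q m and the denominator q^2 m. *)
Let coset_sum_lead y m : 0 < m -> lead y m 1 ->
  lead (\sum_(c : F) (y + cst c)^-1 ^+ q.-1) (- (m * (q * q.-1)%N%:Z)) 1.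
Proof.
move=> m0 hy; rewrite coset_sum; last first.
  move=> c; apply: (@lead1_neq0 _ m).
  by apply: (leadDl _ hy (dle_cst M c)).
have hq n : (0 < n)%N -> lead (y ^+ n) (m * n%:Z) 1.
  by move=> _; rewrite -(expr1n F n); apply: leadX.
have h1 : lead (y ^+ q - y) (m * q%:Z) 1.
  apply: leadDl (dleN (proj1 hy)); first by nia.
  by apply: hq; lia.
have h2 : lead ((y ^+ q) ^+ q - y ^+ q) (m * (q * q)%N%:Z) 1.
  rewrite -exprM; apply: (leadDl (n := m * q%:Z)); first by nia.
    by apply: hq; nia.
  by apply: dleN; apply: (proj1 (hq _ _)); lia.
have := leadM h1 (leadV (oner_neq0 F) h2).
rewrite mul1r invr1; congr lead.
by have -> : (q * q.-1 = q * q - q)%N by [nia]; nia.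
Qed.

(** Apart from 1, the monic elements form full cosets of the constants. By [gap] exactly one of
    these cosets has degree [m1], so its sum is the leading term and cannot be cancelled by the
    others. *)
Lemma zeta1_sub1_lead l : HasSum M S (fun x => x^-1 ^+ q.-1) l ->
  lead (l - 1) (- (m1 * (q * q.-1))%N%:Z) 1.
Proof.
set K := (m1 * (q * q.-1))%N.
(* An error of degree at most -K - 1 does not touch the coefficient at exponent -K. *)
move=> /(HasSum_approx (- K%:Z - 1))[N [s [m1N us sN h]]].
have s1 : 1 \in s by apply/sN; split => //; apply: dle_trans (proj1 (lead1 M)).
(* Coset representatives with zero coefficient at T^0; this excludes 1. *)
pose t := [seq y <- s | co y 0 == 0].
have tP y : y \in t <-> [/\ S y, dle N%:Z y & co y 0 = 0].
  rewrite mem_filter; split; first by move=> /andP[/eqP ? /sN[]].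
  by move=> [Sy hy y0]; rewrite y0 eqxx; apply/sN.
have t_deg y m : y \in t -> lead y m 1 -> y = x1' \/ m1%:Z < m.
  move=> /tP[[Ay _] _ y0] hy; have [mm|mm] := ltP m1%:Z m; [by right | left].
  have [y1|mm'] := S_ge Ay hy.
    by move: y0; rewrite y1 (proj2 (lead1 M)) => /eqP; rewrite oner_eq0.
  have e : m = m1%:Z by lia.
  rewrite e in hy.
  (* Two monic representatives of degree [m1] differ by an element of lower degree, a constant by
     [gap], which is 0 by the normalisation. *)
  have [||c hc] := @gap (y - x1'); first by do !apply: AB => //.
    exact: lead_sub hy lead_x1'.
  apply/subr0_eq; rewrite hc; suff -> : c = 0 by rewrite rmorph0.
  have := congr1 (fun z => co z 0) hc.
  by rewrite /= !lcoefB y0 !lcoef_cst eqxx subrr subr0 => <-.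
have t_pos y : y \in t -> exists2 m, m1%:Z <= m & lead y m 1.
  move=> yt; have /tP[[_ [m hm]] _ _] := yt.
  exists m => //; have [e|] := t_deg _ _ yt hm; last by move/ltW.
  rewrite e in hm.
  by have [-> _] := lead_uniq (oner_neq0 F) (oner_neq0 F) hm lead_x1'.
have ut : uniq t by apply: filter_uniq.
have x1t : x1' \in t.
  apply/tP; split.
  - by split; [apply: AB | exists m1%:Z].
  - by apply: dle_trans (proj1 lead_x1'); rewrite lez_nat.
  - by rewrite lcoefB lcoef_cst eqxx subrr.
(* Adding a constant to an element of positive degree changes neither its degree nor its leading
   coefficient, so the truncation is 1 together with full cosets. *)
have hs : perm_eq s (1 :: [seq y + cst c | y <- t, c <- enum F]).
  apply: uniq_perm => //.
    rewrite /= allpairs_uniq ?enum_uniq // ?andbT.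
      apply/negP => /allpairsP[[y c] /= [yt _ e]].
      have [m hm hy] := t_pos _ yt.
      have : lead 1 m 1 by rewrite e; apply: (leadDl _ hy (dle_cst M c)); lia.
      move=> h1.
      by have [] := lead_uniq (oner_neq0 F) (oner_neq0 F) (lead1 M) h1; lia.
    move=> [y c] [y' c'] /allpairsP[[u v] /= [ut' _ [-> ->]]].
    move=> /allpairsP[[u' v'] /= [ut'' _ [-> ->]]] e.
    have ev : v = v'.
      have := congr1 (fun z => co z 0) e; rewrite /= !lcoef_add.
      have /tP[_ _ ->] := ut'; have /tP[_ _ ->] := ut''.
      by rewrite !lcoef_cst eqxx !add0r.
    by rewrite ev in e *; rewrite (addIr _ e).
  move=> x; rewrite inE; apply/idP/orP.
    move=> /sN[[Ax [m hx]] hN]; case: (S_ge Ax hx) => [/eqP|mm]; [by left|right].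
    apply/allpairsP; exists (x - cst (co x 0), co x 0).
    split; rewrite /= ?mem_enum ?subrK //; apply/tP; split.
    - split; first exact: AB.
      by exists m; apply: (leadDl _ hx (dleN (dle_cst M _))); lia.
    - by apply: dleB => //; apply: dle_trans (dle_cst M _).
    - by rewrite lcoefB lcoef_cst eqxx subrr.
  case=> [/eqP -> //|/allpairsP[[y c] /= [yt _ ->]]].
  have [m hm hy] := t_pos _ yt; have /tP[[Ay _] yN _] := yt.
  apply/sN; split.
    split; first exact: AD.
    by exists m; apply: (leadDl _ hy (dle_cst M c)); lia.
  by apply: dleD => //; apply: dle_trans (dle_cst M _).
move: h; rewrite (perm_big _ hs) big_cons invr1 expr1n big_allpairs_dep.
under eq_bigr do rewrite big_enum /=.
rewrite (perm_big _ (perm_to_rem x1t)) big_cons.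
have := coset_sum_lead _ lead_x1'.
set U := \sum_c _; set R := \sum_(j <- _) _ => hU h.
have hR : dle (- K%:Z - 1) R.
  apply: dle_sum => y; rewrite mem_rem_uniq // inE => /andP[/= y_neq yt] _.
  have [m hm hy] := t_pos _ yt.
  have [e|mm] := t_deg _ _ yt hy; first by rewrite e eqxx in y_neq.
  have m0 : 0 < m by lia.
  have [+ _] := coset_sum_lead m0 hy.
  by apply: dle_trans; rewrite /K; nia.
(* [U], the coset sum of [x1'], dominates; [R] and the truncation error are of smaller degree. *)
have -> : l - 1 = U + (R - (1 + (U + R) - l)) by ring.
apply: (leadDl _ _ (dleB hR h)); first by lia.
by move: hU; rewrite /K PoszM; apply; lia.
Qed.

(** With [l1 = 1 + dl], Frobenius gives [l1 ^+ q.+1 = (1 + dl) * (1 + dl ^+ q)]. In the numerator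
    [l2 - l1 ^+ q.+1] the term [- dl] dominates, since (q+1)(q-1) > q(q-1) bounds the part coming
    from [l2]. *)
Lemma zeta_ratio_lead l1 l2 :
  HasSum M S (fun x => x^-1 ^+ q.-1) l1 ->
  HasSum M S (fun x => x^-1 ^+ (q.+1 * q.-1)) l2 ->
  lead (l2 / l1 ^+ q.+1 - 1) (- (m1 * (q * q.-1))%N%:Z) (-1).
Proof.
move=> /zeta1_sub1_lead h1 /zeta_sub1_dle h2.
set K := (m1 * (q * q.-1))%N in h1 *.
have K0 : (0 < K)%N by rewrite /K; nia.
have K2 : (K < q.+1 * q.-1 * m1)%N.
  by rewrite /K mulnC ltn_pmul2r // ltn_pmul2r //; lia.
set dl := l1 - 1 in h1; set ep := l2 - 1 in h2.
have l1E : l1 ^+ q.+1 = (1 + dl) * (1 + dl ^+ q).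
  by rewrite exprS -[in LHS](subrK 1 l1) addrC (exprD_card cst) expr1n.
have hl1 : lead (l1 ^+ q.+1) 0 1.
  have : lead l1 0 1.
    rewrite -(subrK 1 l1) addrC.
    by apply: (leadDl _ (lead1 M) (proj1 h1)); lia.
  by move/(leadX q.+1); rewrite mul0r expr1n.
have l10 := lead1_neq0 hl1.
have -> : l2 / l1 ^+ q.+1 - 1 =
    (- dl + (ep - dl ^+ q - dl * dl ^+ q)) * (l1 ^+ q.+1)^-1.
  apply: (mulIf l10); rewrite mulrBl mulfVK // mulfVK // mul1r l1E.
  by rewrite /dl /ep; ring.
have hdl : lead (- dl) (- K%:Z) (- 1).
  by split; [apply: dleN; case: h1 | rewrite lcoefN (proj2 h1)].
have hdlq : dle (- K%:Z - 1) (dl ^+ q).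
  by apply: dle_trans (proj1 (leadX q h1)); nia.
have := leadM (leadDl (n := - K%:Z - 1) _ hdl _) (leadV (oner_neq0 F) hl1).
rewrite oppr0 addr0 invr1 mulr1; apply; first by lia.
apply: dleB; first apply: dleB => //.
  by apply: dle_trans h2; lia.
by apply: dle_trans (dle_mul (proj1 h1) hdlq); lia.
Qed.
End Lattice.

(** * The ring A *)

Section Ring.
Variables (F : finFieldType) (L : fieldType) (M : laurent_model F L).
Variables (a : {poly F}) (b : F) (f : L).
Local Notation co := (lcoef M).
Local Notation cst := (lcst M).
Local Notation dle := (dle M).
Local Notation lead := (lead M).
Local Notation ev := (ev M).
Local Notation d := (size a).-1.
Local Notation inA := (inA M f d).

Hypothesis a_monic : a \is monic.
Hypothesis size_a : (1 < size a)%N.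
Hypothesis f_root : f ^+ 2 - ev a * f - cst b = 0.
Hypothesis f_top : co f d <> 0.
Hypothesis f_dle : forall i : int, d%:Z < i -> co f i = 0.

Let d_gt0 : (0 < d)%N.
Proof. by move: size_a; lia. Qed.

Let fE : f ^+ 2 = ev a * f + cst b.
Proof. by apply/subr0_eq; rewrite opprD addrA. Qed.

(** Comparing coefficients of T^(2d) in f^2 = a f + b shows that the nonzero leading coefficient c
    satisfies c^2 = c. *)
Lemma lead_root : lead f d%:Z 1.
Proof.
split=> //; have /eqP f0 := f_top; apply: (mulfI f0).
have hf : dle d%:Z f by [].
rewrite -(lcoef_mul_top hf hf) -expr2 fE lcoef_add dle_cst ?addr0; last by lia.
have [h1 h2] := lead_ev M (monic_neq0 a_monic).
by rewrite (lcoef_mul_top h1 hf) h2 (monicP a_monic) mulr1 mul1r.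
Qed.

(* [A] as an [F]-space: the span of [1] and the [f^k T^i] with [k >= 1], [i < d] *)
Inductive span : L -> Prop :=
| span_cst c : span (cst c)
| span_mon (p : {poly F}) k : (size p <= d)%N -> span (ev p * f ^+ k.+1)
| span_add x y : span x -> span y -> span (x + y).

(* Dividing [p] by [a] and using [a f = f^2 - b] trades degree in [T] for
   powers of [f]. *)
Lemma span_poly (p : {poly F}) k : (size p <= k.+1 * d)%N ->
  span (ev p * f ^+ k.+1).
Proof.
have [n] := ubnP (size p); elim: n p k => // n IH p k pn hp.
have [pd|pd] := leqP (size p) d; first exact: span_mon.
case: k hp => [|k] hp; first by move: hp pd; lia.
have a0 := monic_neq0 a_monic.
set u := p %/ a; set r := p %% a.
have su : size u = (size p - d)%N by rewrite size_divp.
have sr : (size r <= d)%N by rewrite -ltnS prednK ?ltn_modp // ltnW.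
have -> : ev p * f ^+ k.+2 =
    ev u * f ^+ k.+3 + (ev (- b *: u) * f ^+ k.+1 + ev r * f ^+ k.+2).
  rewrite (divp_eq p a) -/u -/r rmorphD rmorphM evZ rmorphN /=.
  have -> : f ^+ k.+3 = f ^+ 2 * f ^+ k.+1 by rewrite -exprD.
  by rewrite [f ^+ k.+2]exprS fE; ring.
have su' : (size u < n)%N.
  apply: leq_trans (_ : size p <= n)%N; rewrite // su ltn_subrL d_gt0.
  exact: leq_ltn_trans pd.
apply: span_add; first by apply: IH => //; rewrite su; nia.
apply: span_add; last exact: span_mon.
have sb : (size (- b *: u) <= size u)%N by apply: size_scale_leq.
by apply: IH; [apply: leq_ltn_trans sb su' | apply: leq_trans sb _; rewrite su; nia].
Qed.

(** Two generators multiply to [ev (p * r) * f ^+ (k + l).+2], with p r of degree below 2d, which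
    [span_poly] covers. *)
Lemma span_mul x y : span x -> span y -> span (x * y).
Proof.
move=> hx; elim: x / hx y => [c|p k hp|x1 x2 _ h1 _ h2] y hy; last first.
- by rewrite mulrDl; apply: span_add; [apply: h1 | apply: h2].
- elim: y / hy => [c|r l hr|y1 y2 _ h1 _ h2]; last by rewrite mulrDr; apply: span_add.
  + rewrite mulrC mulrA -evZ; apply: span_mon.
    by apply: leq_trans hp; apply: size_scale_leq.
  + have -> : ev p * f ^+ k.+1 * (ev r * f ^+ l.+1) = ev (p * r) * f ^+ (k + l).+2.
      by rewrite rmorphM mulrACA -exprD addSn addnS.
    by apply: span_poly; apply: leq_trans (size_polyMleq _ _) _; nia.
- elim: y / hy => [c'|r l hr|y1 y2 _ h1 _ h2]; last by rewrite mulrDr; apply: span_add.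
  + by rewrite -rmorphM; apply: span_cst.
  + rewrite mulrA -evZ; apply: span_mon.
    by apply: leq_trans hr; apply: size_scale_leq.
Qed.

Lemma inA_span x : inA x -> span x.
Proof.
elim=> [c|i hi|y z _ hy _ hz|y z _ hy _ hz].
- exact: span_cst.
- rewrite mulrC -[f]expr1 -evX -rmorphXn; apply: span_mon.
  by rewrite size_polyXn.
- exact: span_add.
- exact: span_mul.
Qed.

(** Packing the expansion into one polynomial evaluated at [f] collects equal powers of [f] and
    gives access to a top coefficient. *)
Lemma span_horner x : span x -> exists P : {poly {poly F}},
  [/\ (size (P`_0)%R <= 1)%N, forall i, (size (P`_i)%R <= d)%N &
      x = (map_poly ev P).[f]].
Proof.
elim=> [c|p k hp|y z _ [P [P0 Pd ->]] _ [R [R0 Rd ->]]].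
- exists c%:P%:P; split; rewrite ?coefC ?size_polyC_leq1 //.
    move=> i; rewrite coefC; case: eqP; rewrite ?size_poly0 ?size_polyC //.
    by case: (c != 0).
  by rewrite map_polyC hornerC /= evC.
- exists (p *: 'X^(k.+1)); split.
  + by rewrite coefZ coefXn mulr0 size_poly0.
  + by move=> i; rewrite coefZ coefXn; case: eqP; rewrite ?mulr1 // mulr0 size_poly0.
  + by rewrite map_polyZ /= map_polyXn hornerZ hornerXn.
- exists (P + R); split.
  + by rewrite coefD (leq_trans (size_polyD _ _)) // geq_max P0.
  + by move=> i; rewrite coefD (leq_trans (size_polyD _ _)) // geq_max Pd Rd.
  + by rewrite rmorphD hornerD.
Qed.

(** For i >= 1 a nonzero term of index i has degree between d i and d i + d - 1; these ranges are
    disjoint, so the last term dominates. *)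
Lemma lead_expansion k c0 (cs : nat -> {poly F}) :
  (0 < k)%N -> (forall i, (size (cs i) <= d)%N) -> cs k != 0 ->
  lead (cst c0 + \sum_(1 <= i < k.+1) ev (cs i) * f ^+ i)
    ((size (cs k)).-1 + d * k)%N%:Z (lead_coef (cs k)).
Proof.
move=> k0 hcs csk; rewrite big_nat_recr //= addrA addrC.
apply: (leadDl (n := (d * k)%N%:Z - 1)).
    by rewrite PoszD; set u := (_ * _)%N; lia.
  have := leadM (lead_ev M csk) (leadX k lead_root).
  by rewrite expr1n mulr1 PoszD PoszM.
apply: dleD; first by apply: dle_trans (dle_cst M c0); nia.
apply: dle_sum => i; rewrite mem_index_iota => /andP[i1 ik] _.
have hi : (size (cs i) <= d.-1.+1)%N by rewrite prednK.
apply: dle_trans (dle_mul (dle_ev M hi) (proj1 (leadX i lead_root))).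
by nia.
Qed.

(** Everything is read off the top coefficient of the expansion in powers of [f]: index 0 gives a
    constant, index k >= 1 a degree of at least d k. *)
Lemma inA_lead x : inA x -> x <> 0 -> exists n c,
  [/\ (n == 0) || (d <= n)%N, c != 0, lead x n%:Z c &
      c = 1 -> monicA M f d x].
Proof.
move=> /inA_span/span_horner[P [P0 Pd xE]] x0.
have P_neq0 : P != 0.
  by apply/eqP => Pz; apply: x0; rewrite xE Pz rmorph0 horner0.
case sP: (size P) => [|k]; first by move/eqP: sP; rewrite size_poly_eq0 (negPf P_neq0).
have Pk : P`_k != 0 by have := P_neq0; rewrite -lead_coef_eq0 lead_coefE sP.
have xE' : x = cst P`_0`_0 + \sum_(1 <= i < k.+1) ev P`_i * f ^+ i.
  rewrite xE (@horner_coef_wide _ k.+1); last by rewrite -sP size_poly.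
  rewrite big_ord_recl /= coef_map /= expr0 mulr1 [in LHS](size1_polyC P0) evC.
  rewrite big_add1 big_mkord; congr (_ + _); apply: eq_bigr => i _.
  by rewrite coef_map.
case: (posnP k) => [k0|k0].
  have xc : x = cst P`_0`_0 by rewrite xE' k0 big_geq // addr0.
  exists 0%N, P`_0`_0; split => //.
  - by apply/eqP => c0; apply: x0; rewrite xc c0 rmorph0.
  - by rewrite xc; apply: lead_cst.
  - by rewrite xc => ->; left; rewrite rmorph1.
have := lead_expansion P`_0`_0 k0 Pd Pk; rewrite -xE' => hx.
exists ((size (P`_k)%R).-1 + d * k)%N, (lead_coef P`_k); split => //.
- by apply/orP; right; nia.
- by rewrite lead_coef_eq0.
- move=> c1; right; exists k, P`_0`_0, (fun i => P`_i); split => //.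
  exact/monicP.
Qed.

Lemma monicA_lead x : monicA M f d x -> exists m, lead x m 1.
Proof.
case=> [->|[k [c0 [cs [k0 hcs csk ->]]]]]; first by exists 0; apply: lead1.
exists ((size (cs k)).-1 + d * k)%N%:Z; rewrite -(monicP csk).
by apply: lead_expansion => //; apply: monic_neq0.
Qed.

Lemma inA1 : inA 1.
Proof. by rewrite -(lcst1 M); apply: inA_cst. Qed.

Lemma inA_lead_exists n : (d <= n)%N -> exists2 e, inA e & lead e n%:Z 1.
Proof.
move=> dn; have e : ((n %/ d).-1.+1 * d + n %% d = n)%N.
  by rewrite prednK ?divn_gt0 // -divn_eq.
exists (f * lT M ^+ (n %% d) * f ^+ (n %/ d).-1).
  apply: inA_mul; first by apply: inA_gen; rewrite ltn_mod.
  elim: (n %/ d).-1 => [|k IH]; first by rewrite expr0; apply: inA1.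
  rewrite exprS; apply: inA_mul IH.
  by have := inA_gen M f d_gt0; rewrite expr0 mulr1.
have := leadM (leadM lead_root (leadX (n %% d) (lead_X M)))
              (leadX (n %/ d).-1 lead_root).
rewrite !expr1n !mul1r; congr (lead _ _ _).
by rewrite -[in RHS]e; nia.
Qed.
End Ring.

(** * Ideals *)

Lemma J_factor_neq0 (F : finFieldType) (L : fieldType) (M : laurent_model F L) :
  (lT M ^+ (#|F| ^ 2) - lT M) / (lT M ^+ #|F| - lT M) ^+ #|F|.+1 != 0.
Proof.
have T_neq n : (1 < n)%N -> lT M ^+ n - lT M != 0.
  move=> n1; apply: (@lead_neq0 _ _ M _ n%:Z 1 (oner_neq0 F)).
  apply: leadDl (dleN (proj1 (lead_X M))); first by lia.
  by have := leadX n (lead_X M); rewrite expr1n mul1r.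
have q1 := finNzRing_gt1 F.
have q2 : (1 < #|F| ^ 2)%N by rewrite -[X in (X < _)%N](exp1n 2) ltn_exp2r.
by apply: mulf_neq0; [|apply/invr_neq0/expf_neq0]; apply: T_neq.
Qed.
Section Ideals.
Variables (F : finFieldType) (L : fieldType) (M : laurent_model F L).
Variables (a : {poly F}) (b : F) (f : L).
Local Notation cst := (lcst M).
Local Notation dle := (dle M).
Local Notation lead := (lead M).
Local Notation d := (size a).-1.
Local Notation inA := (inA M f d).

Hypothesis a_monic : a \is monic.
Hypothesis size_a : (1 < size a)%N.
Hypothesis f_root : f ^+ 2 - ev M a * f - lcst M b = 0.
Hypothesis f_top : lcoef M f d <> 0.
Hypothesis f_dle : forall i : int, d%:Z < i -> lcoef M f i = 0.

(** * An ideal with a monic element of least degree *)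

Section OneIdeal.
Variable I : L -> Prop.
Hypothesis idealI : is_ideal M f d I.

Lemma ideal_cstM c x : I x -> I (cst c * x).
Proof. by case: idealI => _ _ _ h; apply: h; apply: inA_cst. Qed.

Lemma ideal_sub x y : I x -> I y -> I (x - y).
Proof.
move=> Ix Iy; have [_ _ hD _] := idealI; apply: hD => //.
by rewrite -mulN1r -(lcst1 M) -rmorphN; apply: ideal_cstM.
Qed.

Lemma ideal_lead x : I x -> x <> 0 -> exists n c,
  [/\ c != 0, lead x n%:Z c, I (cst c^-1 * x) & lead (cst c^-1 * x) n%:Z 1].
Proof.
move=> Ix x0; have [hA _ _ _] := idealI.
have [n [c [_ c0 hx _]]] :=
  inA_lead a_monic size_a f_root f_top f_dle (hA _ Ix) x0.
exists n, c; split => //; first exact: ideal_cstM.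
by rewrite -(mulVf c0); apply: lead_cstM.
Qed.

Variables (x0 : L) (n0 : nat).
Hypothesis Ix0 : I x0.
Hypothesis lead_x0 : lead x0 n0%:Z 1.
Hypothesis n0_min : forall x n, I x -> lead x n%:Z 1 -> (n0 <= n)%N.

Let x0_neq0 : x0 != 0 := lead_neq0 (oner_neq0 F) lead_x0.

Let dle_divx0 x m : dle (n0%:Z + m) (x0 * x) -> dle m x.
Proof.
move=> h; have := dle_mul (proj1 (leadV (oner_neq0 F) lead_x0)) h.
by rewrite mulKf //; apply: dle_trans; lia.
Qed.

Lemma ideal_small_eq0 x : I x -> dle (n0%:Z - 1) x -> x = 0.
Proof.
move=> Ix hx; apply: contrapT => x_neq0.
have [n [c [c0 hn Icx hcx]]] := ideal_lead Ix x_neq0.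
by have := n0_min Icx hcx; have := lead_dle_lt c0 hn hx; lia.
Qed.

(** Division by leading terms: each degree in [I] exceeds [n0] by 0 or by at least d, hence by the
    degree of some monic element of A. Subtracting a multiple of [x0] therefore lowers the degree of
    any nonzero element. *)
Lemma principal_of_gap :
  (forall x n, I x -> lead x n%:Z 1 -> (n0 < n)%N -> (n0 + d <= n)%N) ->
  principal M f d I.
Proof.
move=> gap; have [hA I0 _ hM] := idealI.
exists x0; split => [|x]; first exact: hA.
split => [Ix|[r [hr ->]]]; last exact: hM.
(* With the bound N - 1, the base case N = 0 means negative degree, which forces zero. *)
have [N hN] : exists N : nat, dle (N%:Z - 1) x.
  have [n hn] := lcoef_bounded M x; exists `|n|.+1.
  by move=> i hi; apply: hn; lia.
elim: N x Ix hN => [|N IH] x Ix hN.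
  exists 0; split; last first.
    by rewrite mul0r; apply: ideal_small_eq0 => //; apply: dle_trans hN; lia.
  by rewrite -(rmorph0 cst); apply: inA_cst.
have [->|/eqP x_neq0] := eqVneq x 0.
  exists 0; split; last by rewrite mul0r.
  by rewrite -(rmorph0 cst); apply: inA_cst.
have [n [c [c0 hn Icx hcx]]] := ideal_lead Ix x_neq0.
have nN := lead_dle_lt c0 hn hN; have n0n := n0_min Icx hcx.
have [e Ae he] : exists2 e, inA e & lead e (n - n0)%N%:Z 1.
  have [nn|nn] := ltnP n0 n; last first.
    have -> : (n - n0 = 0)%N by lia.
    by exists 1; [apply: inA1 | apply: lead1].
  apply: (inA_lead_exists a_monic size_a f_root f_top f_dle).
  by have := gap _ _ Icx hcx nn; lia.
have lt : lead (cst c * (e * x0)) n%:Z c.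
  have := lead_cstM c (leadM he lead_x0); rewrite !mulr1; congr (lead _ _ _); lia.
have [||r [hr hxr]] := IH (x - cst c * (e * x0)).
- by apply: ideal_sub => //; apply: ideal_cstM; apply: hM.
- by apply: dle_trans (lead_sub hn lt); lia.
exists (r + cst c * e); split.
  by apply: inA_add => //; apply: inA_mul => //; apply: inA_cst.
by rewrite mulrDl -hxr mulrA subrK.
Qed.

Variables (m1 : nat) (x1 : L).
Hypothesis m1_gt0 : (0 < m1)%N.
Hypothesis Ix1 : I x1.
Hypothesis lead_x1 : lead x1 (n0 + m1)%N%:Z 1.
Hypothesis gap :
  forall x n, I x -> lead x n%:Z 1 -> (n0 < n)%N -> (n0 + m1 <= n)%N.

(** The lattice x0^(-1) I: it contains 1 and its nonzero elements have degree at least 0. *)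
Let Lam (x : L) := I (x0 * x).

Let LamD x y : Lam x -> Lam y -> Lam (x + y).
Proof. by rewrite /Lam mulrDr; case: idealI => _ _ + _; apply. Qed.

Let LamZ c x : Lam x -> Lam (cst c * x).
Proof. by rewrite /Lam mulrCA; apply: ideal_cstM. Qed.

Let Lam1 : Lam 1. Proof. by rewrite /Lam mulr1. Qed.

Let Lam_discrete x : Lam x -> dle (-1) x -> x = 0.
Proof.
move=> hx h; apply/eqP; have := ideal_small_eq0 hx (dle_mul (proj1 lead_x0) h).
by move/eqP; rewrite mulf_eq0 (negPf x0_neq0).
Qed.

Let lead_Lam_x1 : lead (x0^-1 * x1) m1%:Z 1.
Proof.
have := leadM (leadV (oner_neq0 F) lead_x0) lead_x1.
by rewrite mulr1 invr1; congr (lead _ _ _); lia.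
Qed.

Let Lam_x1 : Lam (x0^-1 * x1). Proof. by rewrite /Lam mulVKf. Qed.

(** By [gap], a nonzero element of degree below [m1] has degree 0; subtracting its leading
    coefficient leaves negative degree, hence 0. *)
Let Lam_gap x : Lam x -> dle (m1%:Z - 1) x -> exists c, x = cst c.
Proof.
move=> hx h; have [->|x_neq0] := eqVneq x 0; first by exists 0; rewrite rmorph0.
have /eqP y_neq0 : x0 * x != 0 by apply: mulf_neq0.
have [n [c [c0 hn Icx hcx]]] := ideal_lead hx y_neq0.
have n0n := n0_min Icx hcx.
have n1n := lead_dle_lt c0 hn (dle_mul (proj1 lead_x0) h).
have en : n = n0.
  by have := gap Icx hcx; case: (ltnP n0 n) => [? /(_ isT)|]; lia.
rewrite en in hn; exists c; apply/subr0_eq/Lam_discrete.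
  rewrite /Lam mulrBr; apply: ideal_sub => //.
  by rewrite mulrC; apply: ideal_cstM.
apply: dle_divx0; rewrite mulrBr [x0 * cst c]mulrC.
by apply: lead_sub hn _; have := lead_cstM c lead_x0; rewrite mulr1.
Qed.

Local Notation SI := (fun x => [/\ I x, x <> 0 & monicA M f d x]).

(** Multiplication by [x0] preserves leading coefficient 1, which on nonzero elements of A is
    equivalent to [monicA]. *)
Let SI_Lam x : SI (x0 * x) <-> monic_part M Lam x.
Proof.
have [hA _ _ _] := idealI; split.
  move=> [Ix _ /(monicA_lead a_monic size_a f_root f_top f_dle)[m hm]].
  split => //; exists (- n0%:Z + m).
  have := leadM (leadV (oner_neq0 F) lead_x0) hm.
  by rewrite mulKf // invr1 mulr1.
move=> [Ix [m hm]]; have hxm := leadM lead_x0 hm; rewrite mulr1 in hxm.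
have /eqP hx := lead_neq0 (oner_neq0 F) hxm; split => //.
have [n [c [_ c0 hc]]] :=
  inA_lead a_monic size_a f_root f_top f_dle (hA _ Ix) hx; apply.
by have [] := lead_uniq c0 (oner_neq0 F) hc hxm.
Qed.

Let HasSum_zetaI n : (0 < n)%N ->
  HasSum M (monic_part M Lam) (fun x => x^-1 ^+ (n * #|F|.-1))
    (x0 ^+ (n * #|F|.-1) * zetaI M f d I n).
Proof.
move=> n_gt0; have q_gt1 := finNzRing_gt1 F.
have e_gt0 : (0 < n * #|F|.-1)%N by rewrite muln_gt0 n_gt0 -subn1 subn_gt0.
have SIE : (fun x => SI (x0 * x)) = monic_part M Lam.
  by apply: funext => x; apply: propext; apply: SI_Lam.
rewrite -SIE; apply: (@HasSum_scale _ _ M SI) => //.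
(* [epsilon] yields a genuine sum once one exists; scaling the lattice sum back by [x0^-1] provides
   it. *)
rewrite /zetaI /sumL /q subn1; apply: ClassicalEpsilon.epsilon_spec.
have [l hl] := HasSum_monic_part LamD LamZ Lam_discrete e_gt0.
have := HasSum_scale (invr_neq0 x0_neq0) hl; set l' := _ * l => hl'.
exists l'; move: hl'; congr (HasSum M _ _ _); apply: funext => x.
by apply: propext; rewrite -SI_Lam mulVKf.
Qed.

(** The powers of [x0] from the rescaling have the same exponent (q+1)(q-1) above and below, so the
    ratio is that of the lattice. *)
Lemma zetaI_ratio_lead :
  lead (zetaI M f d I #|F|.+1 / zetaI M f d I 1 ^+ #|F|.+1 - 1)
    (- (m1 * (#|F| * #|F|.-1))%N%:Z) (-1).
Proof.
have h1 := @HasSum_zetaI 1 isT; rewrite !mul1n in h1.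
have := zeta_ratio_lead LamD LamZ Lam1 Lam_discrete m1_gt0 Lam_x1 lead_Lam_x1
  Lam_gap h1 (HasSum_zetaI (ltn0Sn _)).
congr (lead (_ - 1) _ _).
rewrite exprMn -exprM mulnC invfM mulrACA divff ?mul1r //.
exact: expf_neq0.
Qed.
End OneIdeal.

Lemma inA_ideal : is_ideal M f d inA.
Proof.
split => // [|x y|r x]; [|exact: inA_add|exact: inA_mul].
by rewrite -(rmorph0 cst); apply: inA_cst.
Qed.

Lemma zetaA_ratio_lead :
  lead (zetaI M f d inA #|F|.+1 / zetaI M f d inA 1 ^+ #|F|.+1 - 1)
    (- (d * (#|F| * #|F|.-1))%N%:Z) (-1).
Proof.
have [e Ae he] := inA_lead_exists a_monic size_a f_root f_top f_dle (leqnn d).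
(* Here 1 has least degree 0, and d is the next degree that occurs. *)
apply: (@zetaI_ratio_lead inA inA_ideal 1 0%N _ _ _ d e) => //.
- exact: inA1.
- exact: lead1.
- by move: size_a; lia.
- move=> x n Ax hx n_gt0; have /eqP x0 := lead_neq0 (oner_neq0 F) hx.
  have [k [c [hk c0 hc _]]] := inA_lead a_monic size_a f_root f_top f_dle Ax x0.
  have [e1 _] := lead_uniq c0 (oner_neq0 F) hc hx.
  by move: hk; case: e1 => ->; rewrite add0n eqn0Ngt n_gt0.
Qed.

Lemma nonprincipal_ratio_lead (I : L -> Prop) :
  is_ideal M f d I -> (exists x, I x /\ x <> 0) -> ~ principal M f d I ->
  exists2 m : nat, (m < d)%N &
  lead (zetaI M f d I #|F|.+1 / zetaI M f d I 1 ^+ #|F|.+1 - 1)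
    (- (m * (#|F| * #|F|.-1))%N%:Z) (-1).
Proof.
move=> idI [x [Ix x_neq0]] nprinc.
pose P n := `[< exists x, I x /\ lead x n%:Z 1 >].
have exP : exists n, P n.
  have [n [c [_ _ Icx hcx]]] := ideal_lead idI Ix x_neq0.
  by exists n; apply/asboolP; exists (cst c^-1 * x).
case: (ex_minnP exP) => n0 /asboolP[x0 [Ix0 hx0]] n0_min'.
have n0_min y n : I y -> lead y n%:Z 1 -> (n0 <= n)%N.
  by move=> Iy hy; apply: n0_min'; apply/asboolP; exists y.
(* Without a degree strictly between [n0] and [n0 + d] the ideal would be principal. The least
   degree [n1] above [n0] then gives m = n1 - n0 < d. *)
have [y [n [Iy hy n0n nd]]] : exists y n,
    [/\ I y, lead y n%:Z 1, (n0 < n)%N & (n < n0 + d)%N].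
  apply: contrapT => h; apply: nprinc.
  apply: (principal_of_gap idI Ix0 hx0 n0_min) => y n Iy hy n0n.
  by rewrite leqNgt; apply/negP => nd; apply: h; exists y, n.
pose Q n := (n0 < n)%N && P n.
have exQ : exists n, Q n by exists n; rewrite /Q n0n; apply/asboolP; exists y.
case: (ex_minnP exQ) => n1 /andP[n01 /asboolP[x1 [Ix1 hx1]]] n1_min.
have gap z k : I z -> lead z k%:Z 1 -> (n0 < k)%N -> (n1 <= k)%N.
  by move=> Iz hz nk; apply: n1_min; rewrite /Q nk; apply/asboolP; exists z.
have n1n := gap _ _ Iy hy n0n.
have n1E : (n0 + (n1 - n0) = n1)%N by rewrite subnKC // ltnW.
exists (n1 - n0)%N; first by rewrite ltn_subLR ?(ltnW n01) // (leq_ltn_trans n1n).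
apply: (zetaI_ratio_lead idI Ix0 hx0 n0_min _ Ix1); rewrite ?n1E //.
by rewrite subn_gt0.
Qed.

End Ideals.

Theorem theorem5 (F : finFieldType) (L : fieldType) (M : laurent_model F L)
    (a : {poly F}) (b : F) (f : L) :
  a \is monic -> (1 < size a)%N -> b != 0 ->
  f ^+ 2 - ev M a * f - lcst M b = 0 ->
  (forall p r : {poly F}, r != 0 -> f * ev M r <> ev M p) ->
  lcoef M f (size a).-1 <> 0 ->
  (forall i : int, (size a).-1%:Z < i -> lcoef M f i = 0) ->
  forall I : L -> Prop,
    is_ideal M f (size a).-1 I -> (exists x, I x /\ x <> 0) ->
    ~ principal M f (size a).-1 I ->
    jI M f (size a).-1 I <> jI M f (size a).-1 (inA M f (size a).-1).
Proof.
move=> a_monic size_a _ f_root _ f_top f_dle I idI I_neq0 nprinc.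
(* Inversion is injective even at 0, since 0 is its own inverse by convention; equal values of j
   thus reduce to equal zeta ratios. *)
move=> /invr_inj/addrI/oppr_inj/(mulfI (J_factor_neq0 M)).
have [m md hI] :=
  nonprincipal_ratio_lead a_monic size_a f_root f_top f_dle idI I_neq0 nprinc.
have hA := zetaA_ratio_lead a_monic size_a f_root f_top f_dle.
rewrite /q => e; rewrite e in hI.
have n1 : - 1 != 0 :> F by rewrite oppr_eq0 oner_neq0.
(* Equal ratios would give m q (q-1) = d q (q-1), contradicting m < d. *)
have [/oppr_inj[/eqP]] := lead_uniq n1 n1 hI hA.
have q_gt1 := finNzRing_gt1 F.
rewrite eqn_pmul2r ?(ltn_eqF md) // muln_gt0 -!subn1 subn_gt0 q_gt1 andbT.
exact: ltnW.
Qed.
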